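(* Let $\Omega\subseteq\mathbb{R}^2$ be open, let $P\subset\Omega$ be a compact polygon, and let $s:\Omega\to\mathbb{R}^n$ be a smooth surface. Consider finite partitions $\Pi$ of $P$ into non-overlapping nondegenerate oriented triangles $[a_i,b_i,c_i]$, each balanced in $\Omega$, where the vertices are labelled so that $a_i'$, the mirror vertex of $a_i$ (the reflection of $a_i$ across the line through $b_i$ and $c_i$), is a balanced mirror vertex with the triangle $a_i',b_i,c_i$ contained in $\Omega$. Let $\|\Pi\|$ be the maximal side length of the triangles in $\Pi$. Then $$\lim_{\|\Pi\|\to 0}\ \frac14\sum_{[a_i,b_i,c_i]\in\Pi}\Big|\big[s(a_i')-s(a_i)\big]\wedge\big[s(c_i)-s(b_i)\big]\Big| \;=\; \int_P\big|\partial_1 s(x)\wedge\partial_2 s(x)\big|\,dx,$$ i.e. for every $\varepsilon>0$ there is $\delta>0$ such that for every such partition $\Pi$ with $\|\Pi\|<\delta$ the sum differs from the integral by less than $\varepsilon$.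
   Context: Two sets are non-overlapping if their interiors are disjoint; the partition need not be a triangulation. $\wedge$ is the exterior product and $|\cdot|$ is the Euclidean norm on $\Lambda^2\mathbb{R}^n$ for which $\{h_j\wedge h_k\}_{j<k}$ is orthonormal when $\{h_j\}$ is an orthonormal basis of $\mathbb{R}^n$. $\partial_i s(x)=\sum_j\partial_{\ell_i}\sigma_j(x)h_j$ for an orthonormal basis $\{\ell_1,\ell_2\}$ of $\mathbb{R}^2$ and $\sigma_j=s\cdot h_j$. A real function on $\Omega$ is smooth if it is $C^2$ and the eigenvalues of its Hessian are bounded in absolute value uniformly on $\Omega$; $s$ is a smooth surface if all components $\sigma_j$ are smooth. For a nondegenerate triangle with vertices $x,x_+,x_-$, the mirror vertex of $x$ is its reflection $x'$ across the line through $x_+,x_-$; it is balanced if $\frac12(x+x')$ lies in the segment $[x_+,x_-]$. A triangle $\Delta$ is balanced in $\Omega$ if $\Delta\subset\Omega$ and for some vertex $x$ of $\Delta$ the mirror vertex $x'$ is balanced and the triangle with vertices $x',x_+,x_-$ is contained in $\Omega$. *)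

(* Defs.v *)
From HB Require Import structures.
From mathcomp Require Import all_boot all_order all_algebra.
From mathcomp Require Import all_classical all_reals all_analysis.
Set Implicit Arguments.
Unset Strict Implicit.
Unset Printing Implicit Defensive.
Import Order.TTheory GRing.Theory Num.Theory.
Import numFieldNormedType.Exports.
Local Open Scope classical_set_scope.
Local Open Scope ring_scope.

Section Defs.
Variable R : realType.

Notation pt := (R * R)%type.

Definition dist2 (x y : pt) : R :=
  Num.sqrt ((x.1 - y.1) ^+ 2 + (x.2 - y.2) ^+ 2).

Definition segment (x y : pt) : set pt :=
  [set z | exists2 t : R, 0 <= t <= 1 &
     z = ((1 - t) * x.1 + t * y.1, (1 - t) * x.2 + t * y.2)].

Definition triangle (a b c : pt) : set pt :=
  [set z | exists l1 l2 l3 : R, [/\ 0 <= l1, 0 <= l2, 0 <= l3,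
     l1 + l2 + l3 = 1 &
     z = (l1 * a.1 + l2 * b.1 + l3 * c.1, l1 * a.2 + l2 * b.2 + l3 * c.2)]].

Definition nondegenerate (a b c : pt) : Prop :=
  (b.1 - a.1) * (c.2 - a.2) - (b.2 - a.2) * (c.1 - a.1) != 0.

Definition proj_param (x p q : pt) : R :=
  ((x.1 - p.1) * (q.1 - p.1) + (x.2 - p.2) * (q.2 - p.2)) /
  ((q.1 - p.1) ^+ 2 + (q.2 - p.2) ^+ 2).

Definition proj_line (x p q : pt) : pt :=
  (p.1 + proj_param x p q * (q.1 - p.1), p.2 + proj_param x p q * (q.2 - p.2)).

Definition mirror (x p q : pt) : pt :=
  (2 * (proj_line x p q).1 - x.1, 2 * (proj_line x p q).2 - x.2).

Definition midpoint (x y : pt) : pt := ((x.1 + y.1) / 2, (x.2 + y.2) / 2).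

Definition balanced_mirror (x p q : pt) : Prop :=
  segment p q (midpoint x (mirror x p q)).

Definition balanced_at (Omega : set pt) (a b c : pt) : Prop :=
  [/\ triangle a b c `<=` Omega, balanced_mirror a b c &
      triangle (mirror a b c) b c `<=` Omega].

Definition compact_polygon (P : set pt) : Prop :=
  exists ts : seq (pt * pt * pt),
    [/\ ts != [::],
        all (fun t => `[< nondegenerate t.1.1 t.1.2 t.2 >]) ts &
        P = \bigcup_(t in [set t | t \in ts]) triangle t.1.1 t.1.2 t.2].

Definition tri_of (t : pt * pt * pt) : set pt := triangle t.1.1 t.1.2 t.2.

Definition admissible_partition (Omega P : set pt) (Pi : seq (pt * pt * pt))
  : Prop :=
  [/\ (forall t, t \in Pi -> nondegenerate t.1.1 t.1.2 t.2),
      (forall t, t \in Pi -> balanced_at Omega t.1.1 t.1.2 t.2),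
      (forall i j : nat, (i < size Pi)%N -> (j < size Pi)%N -> i <> j ->
          interior (tri_of (nth (0, 0, 0) Pi i)) `&`
          interior (tri_of (nth (0, 0, 0) Pi j)) = set0) &
      P = \bigcup_(t in [set t | t \in Pi]) tri_of t].

Definition tri_diam (t : pt * pt * pt) : R :=
  Num.max (dist2 t.1.1 t.1.2) (Num.max (dist2 t.1.2 t.2) (dist2 t.2 t.1.1)).

Definition mesh (Pi : seq (pt * pt * pt)) : R :=
  \big[Num.max/0]_(t <- Pi) tri_diam t.

Definition e1 : pt := (1, 0).
Definition e2 : pt := (0, 1).
Definition ebasis (i : 'I_2) : pt := if val i == 0%N then e1 else e2.

Definition ix1 : 'I_2 := @ord0 1.
Definition ix2 : 'I_2 := @ord_max 1.

Definition pd (i : 'I_2) (f : pt -> R) : pt -> R := 'D_(ebasis i) f.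

Definition hessian (f : pt -> R) (x : pt) : 'M[R]_2 :=
  \matrix_(i < 2, j < 2) pd j (pd i f) x.

Definition C2_on (Omega : set pt) (f : pt -> R) : Prop :=
  forall x, Omega x ->
  [/\ f @ x --> f x,
      (forall i, derivable f x (ebasis i)),
      (forall i, pd i f @ x --> pd i f x),
      (forall i j, derivable (pd i f) x (ebasis j)) &
      (forall i j, pd j (pd i f) @ x --> pd j (pd i f) x)].

Definition smooth_on (Omega : set pt) (f : pt -> R) : Prop :=
  C2_on Omega f /\
  exists M : R, forall x, Omega x -> forall lam : R,
      eigenvalue (hessian f x) lam -> `|lam| <= M.

Definition comp (n : nat) (s : pt -> 'rV[R]_n) (j : 'I_n) : pt -> R :=
  fun x => s x ord0 j.

Definition smooth_surface (n : nat) (Omega : set pt) (s : pt -> 'rV[R]_n)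
  : Prop := forall j, smooth_on Omega (comp s j).

Definition pds (n : nat) (i : 'I_2) (s : pt -> 'rV[R]_n) (x : pt) : 'rV[R]_n :=
  \row_j pd i (comp s j) x.

(* Euclidean norm of u /\ v in Lambda^2 R^n, for which {h_j /\ h_k}_{j<k}
   is orthonormal: u /\ v = \sum_{j<k} (u_j v_k - u_k v_j) h_j /\ h_k *)
Definition wedge_norm (n : nat) (u v : 'rV[R]_n) : R :=
  Num.sqrt (\sum_(j < n) \sum_(k < n | (j < k)%N)
              (u ord0 j * v ord0 k - u ord0 k * v ord0 j) ^+ 2).

Definition mirror_sum (n : nat) (s : pt -> 'rV[R]_n) (Pi : seq (pt * pt * pt))
  : R :=
  4^-1 * \sum_(t <- Pi)
     wedge_norm (s (mirror t.1.1 t.1.2 t.2) - s t.1.1) (s t.2 - s t.1.2).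

Definition leb2 := ((@lebesgue_measure R) \x (@lebesgue_measure R))%E.

End Defs.

(* Main.v *)
Require Import Defs.
From HB Require Import structures.
From mathcomp Require Import all_boot all_order all_algebra.
From mathcomp Require Import all_classical all_reals all_analysis.
From mathcomp Require Import measurable_realfun.
From mathcomp Require Import ring lra.
Import Order.TTheory GRing.Theory Num.Theory.
Import numFieldNormedType.Exports.
Local Open Scope classical_set_scope.
Local Open Scope ring_scope.

(** For a triangle [a, b, c] with base [b, c], the vectors [N = a' - a] and
    [T = c - b] are orthogonal and [N x T] is four times the area.  Applying the
    mean value theorem along horizontal and vertical segments in a small square
    around [b], [s a' - s a] and [s c - s b] are the images of [N] and [T] under
    the differential of [s] at [b], up to [o(|N|)] and [o(|T|)], uniformly by
    compactness of [P].  Hence each term of the sum is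
    [area * |d1 s /\ d2 s|(b) + o(|N| |T|)], and orthogonality gives
    [|N| |T| = O(area)].  The integral over the triangle is
    [area * |d1 s /\ d2 s|(b) + o(area)] by uniform continuity; the errors add up
    to [o(1)] times the area of [P]. *)

(** * Uniform continuity near a compact set and first-order increments *)

Section compact_estimates.
Variable R : realType.

(** A covering argument: a radius [r] that works at [x] gives the radius [r / 2] at every point
    within [r / 2] of [x]. The point [y] may leave [K], as a mirror vertex may leave the polygon.
    The bound is stated for all small [d] so that finitely many functions can share one radius. *)
Lemma near_compact_ball (K Om : set (R * R)) (g : R * R -> R) e :
  compact K -> open Om -> K `<=` Om -> 0 < e ->
  (forall x, Om x -> {for x, continuous g}) ->
  \forall d \near 0^'+, forall x y, K x -> ball x d y ->
     Om y /\ `|g y - g x| < e.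
Proof.
move=> cK oO KO e0 cg.
have : \forall d \near 0^'+, K `<=` (fun x => forall y, ball x d y ->
     Om y /\ `|g y - g x| < e).
  move/compact_near_coveringP : cK; apply => x Kx.
  have e20 : 0 < e / 2 by rewrite divr_gt0.
  have /cvgrPdist_lt/(_ _ e20) ge := cg x (KO _ Kx).
  have Ox : nbhs x Om by apply: open_nbhs_nbhs; split => //; exact: KO.
  have [r /= r0 rP] := (nbhs_ballP _ _).1 (filterI Ox ge).
  have r20 : 0 < r / 2 by rewrite divr_gt0.
  exists (ball x (r / 2), [set d | d <= r / 2]).
    split; first exact: nbhsx_ballx.
    exact: nbhs_right_le.
  move=> [x' d] /= [xx' dr] y x'y.
  have xy : ball x r y.
    by rewrite [r]splitr; apply: ball_triangle xx' _; apply: le_ball x'y.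
  have xx'2 : ball x r x'.
    by apply: le_ball xx'; rewrite ler_pdivrMr// mulr2n mulrDr mulr1 lerDl ltW.
  have [Oy gy] := rP _ xy.
  have [_ gx'] := rP _ xx'2.
  split => //.
  rewrite [e]splitr.
  rewrite (_ : g y - g x' = (g x - g x') - (g x - g y)); last by ring.
  by rewrite (le_lt_trans (ler_normB _ _))// ltrD.
by apply: filterS => d H x y Kx; exact: H.
Qed.

Lemma compact_norm_bound (K Om : set (R * R)) (g : R * R -> R) :
  compact K -> K `<=` Om ->
  (forall x, Om x -> {for x, continuous g}) ->
  \forall M \near +oo, forall x, K x -> `|g x| <= M.
Proof.
move=> cK KO cg.
have : \forall M \near +oo, K `<=` (fun x => `|g x| <= M).
  move/compact_near_coveringP : cK; apply => x Kx.
  have /cvgrPdist_lt/(_ _ ltr01) ge := cg x (KO _ Kx).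
  exists ([set y | `|g x - g y| < 1], [set M | `|g x| + 1 <= M]).
    by split => //=; exact: nbhs_pinfty_ge.
  move=> [y M] /= [gy]; apply: le_trans.
  have -> : g y = g x - (g x - g y) by ring.
  by rewrite (le_trans (ler_normB _ _))// lerD2l ltW.
by apply: filterS => d H x Kx; exact: H.
Qed.

Lemma ball_pairE (x y : R * R) d :
  ball x d y <-> `|x.1 - y.1| < d /\ `|x.2 - y.2| < d.
Proof. by []. Qed.

(** The one-variable mean value theorem for [f] restricted to a horizontal line. The endpoints come
    in either order because increments are later taken between arbitrary points. *)
Lemma partial_MVT1 (f : R * R -> R) (p q c : R) :
  (forall t, (p <= t <= q) || (q <= t <= p) -> derivable f (t, c) (e1 R)) ->
  exists2 t, (p <= t <= q) || (q <= t <= p) &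
    f (q, c) - f (p, c) = (q - p) * pd ix1 f (t, c).
Proof.
(* The difference quotients of the restriction are those of [f] in the direction [e1], so
   derivability and derivative both transfer. *)
have E (t : R) :
    (fun h : R => h^-1 *: (((f \o (fun u => (u, c))) \o shift t) (h *: 1) - f (t, c))) =
    (fun h : R => h^-1 *: ((f \o shift (t, c)) (h *: e1 R) - f (t, c))).
  apply/funext => h /=.
  have -> : h *: e1 R + (t, c) = (h *: 1 + t, h * 0 + c) by [].
  by rewrite mulr0 add0r.
wlog : p q / p <= q => [H D|pq D].
  have [pq|/ltW qp] := leP p q; first exact: H.
  have [|t tP E1] := H q p qp; first by move=> t; rewrite orbC; exact: D.
  exists t; first by rewrite orbC.
  by rewrite -opprB E1 -mulNr opprB.
have [||t tpq E1] := @MVT_segment R (f \o (fun u => (u, c)))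
  (fun t => pd ix1 f (t, c)) p q pq.
- move=> t /andP[/= /ltW pt /ltW tq]; apply: DeriveDef => /=.
    by rewrite /derivable E; apply: D; rewrite pt tq.
  by rewrite /derive E.
- apply: derivable_within_continuous => t tpq.
  by rewrite /derivable E; apply: D; move: tpq; rewrite in_itv /= => ->.
- by exists t; [move: tpq; rewrite in_itv /= => -> | rewrite mulrC; exact: E1].
Qed.

Lemma partial_MVT2 (f : R * R -> R) (p q c : R) :
  (forall t, (p <= t <= q) || (q <= t <= p) -> derivable f (c, t) (e2 R)) ->
  exists2 t, (p <= t <= q) || (q <= t <= p) &
    f (c, q) - f (c, p) = (q - p) * pd ix2 f (c, t).
Proof.
have E (t : R) :
    (fun h : R => h^-1 *: (((f \o (fun u => (c, u))) \o shift t) (h *: 1) - f (c, t))) =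
    (fun h : R => h^-1 *: ((f \o shift (c, t)) (h *: e2 R) - f (c, t))).
  apply/funext => h /=.
  have -> : h *: e2 R + (c, t) = (h * 0 + c, h *: 1 + t) by [].
  by rewrite mulr0 add0r.
wlog : p q / p <= q => [H D|pq D].
  have [pq|/ltW qp] := leP p q; first exact: H.
  have [|t tP E1] := H q p qp; first by move=> t; rewrite orbC; exact: D.
  exists t; first by rewrite orbC.
  by rewrite -opprB E1 -mulNr opprB.
have [||t tpq E1] := @MVT_segment R (f \o (fun u => (c, u)))
  (fun t => pd ix2 f (c, t)) p q pq.
- move=> t /andP[/= /ltW pt /ltW tq]; apply: DeriveDef => /=.
    by rewrite /derivable E; apply: D; rewrite pt tq.
  by rewrite /derive E.
- apply: derivable_within_continuous => t tpq.
  by rewrite /derivable E; apply: D; move: tpq; rewrite in_itv /= => ->.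
- by exists t; [move: tpq; rewrite in_itv /= => -> | rewrite mulrC; exact: E1].
Qed.

Lemma between_ball (x p q t d : R) : `|x - p| < d -> `|x - q| < d ->
  (p <= t <= q) || (q <= t <= p) -> `|x - t| < d.
Proof.
rewrite !ltr_norml => /andP[? ?] /andP[? ?] /orP[] /andP[? ?]; apply/andP; split; lra.
Qed.

(** Go from [z] to [y] through the corner [(z.1, y.2)]. Balls of the product metric are squares, so
    both legs stay in the ball, and the mean value theorem applies to each leg. *)
Lemma increment_bound (f : R * R -> R) (x y z : R * R) d e :
  (forall u, ball x d u -> forall i, derivable f u (ebasis R i)) ->
  (forall u, ball x d u -> forall i, `|pd i f u - pd i f x| <= e) ->
  ball x d y -> ball x d z ->
  `|f y - f z - ((y.1 - z.1) * pd ix1 f x + (y.2 - z.2) * pd ix2 f x)|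
     <= e * (`|y.1 - z.1| + `|y.2 - z.2|).
Proof.
move=> D B; case: y z => [y1 y2] [z1 z2].
move=> /ball_pairE[/= xy1 xy2] /ball_pairE[/= xz1 xz2].
have [|t tP E1] := @partial_MVT1 f z1 y1 y2.
  by move=> t tP; apply: (D _ _ ix1); split => //=; exact: between_ball tP.
have [|u uP E2] := @partial_MVT2 f z2 y2 z1.
  by move=> u uP; apply: (D _ _ ix2); split => //=; exact: between_ball uP.
have Bt : `|pd ix1 f (t, y2) - pd ix1 f x| <= e.
  by apply: B; split => //=; exact: between_ball tP.
have Bu : `|pd ix2 f (z1, u) - pd ix2 f x| <= e.
  by apply: B; split => //=; exact: between_ball uP.
have -> : f (y1, y2) - f (z1, z2) =
  (f (y1, y2) - f (z1, y2)) + (f (z1, y2) - f (z1, z2)) by ring.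
rewrite {}E1 {}E2.
move: (pd ix1 f (t, y2)) (pd ix2 f (z1, u)) (pd ix1 f x) (pd ix2 f x) Bt Bu.
move=> P1 Q1 P2 Q2 Bt Bu.
rewrite (_ : _ - _ = (y1 - z1) * (P1 - P2) + (y2 - z2) * (Q1 - Q2)); last by ring.
rewrite (le_trans (ler_normD _ _))// !normrM mulrDr.
by rewrite lerD// mulrC ler_wpM2r.
Qed.

End compact_estimates.

(** * The norm of a wedge product: Lipschitz bound, homogeneity, continuity *)

Section wedge_norm_theory.
Variable R : realType.

(** Minkowski's inequality combined with the bound of the Euclidean norm by the sum of absolute
    values, by induction on the list. *)
Lemma sqrt_sum_sqr_le (I : Type) (r : seq I) (P : pred I) (x y : I -> R) :
  Num.sqrt (\sum_(i <- r | P i) x i ^+ 2) <=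
  Num.sqrt (\sum_(i <- r | P i) y i ^+ 2) + \sum_(i <- r | P i) `|x i - y i|.
Proof.
have S0 (z : I -> R) s : 0 <= \sum_(i <- s | P i) z i ^+ 2.
  by apply: sumr_ge0 => i _; exact: sqr_ge0.
elim: r => [|i r IH]; first by rewrite !big_nil sqrtr0 addr0.
rewrite !big_cons; case: (P i) => //.
set X := \sum_(i <- r | P i) x i ^+ 2 in IH *.
set Y := \sum_(i <- r | P i) y i ^+ 2 in IH *.
set D := \sum_(i <- r | P i) _ in IH *.
have D0 : 0 <= D by apply: sumr_ge0.
have X0 : 0 <= X by exact: S0.
have Y0 : 0 <= Y by exact: S0.
rewrite -{1}(sqr_sqrtr X0) -{1}(sqr_sqrtr Y0).
have := sqrtr_ge0 X; have := sqrtr_ge0 Y.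
move: (Num.sqrt X) (Num.sqrt Y) IH => a b IH b0 a0.
set w := Num.sqrt (y i ^+ 2 + b ^+ 2).
have w0 : 0 <= w by exact: sqrtr_ge0.
have w2 : w ^+ 2 = y i ^+ 2 + b ^+ 2 by rewrite sqr_sqrtr// addr_ge0// sqr_ge0.
have bw : b <= w by rewrite -(@ler_pXn2r _ 2)// ?nnegrE// w2 lerDr sqr_ge0.
have yw : `|y i| <= w.
  by rewrite -(@ler_pXn2r _ 2)// ?nnegrE// w2 real_normK ?num_real// lerDl sqr_ge0.
(* Squaring leaves a polynomial inequality; its cross terms are controlled by [|y i| <= w] and
   [b <= w]. *)
have -> : w + (`|x i - y i| + D) = Num.sqrt ((w + (`|x i - y i| + D)) ^+ 2).
  by rewrite sqrtr_sqr [RHS]ger0_norm// addr_ge0// addr_ge0.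
rewrite ler_wsqrtr//.
have -> : x i = y i + (x i - y i) by ring.
move: (x i - y i) => t.
rewrite (_ : y i + t - y i = t); last by ring.
have h1 : a ^+ 2 <= (b + D) ^+ 2 by rewrite ler_pXn2r ?nnegrE// addr_ge0.
have h2 : y i * t <= w * `|t|.
  by rewrite (le_trans (ler_norm _))// normrM ler_wpM2r.
have h3 : t ^+ 2 = `|t| ^+ 2 by rewrite real_normK ?num_real.
have h4 : b * D <= w * D by rewrite ler_wpM2r.
have := normr_ge0 t.
have : 0 <= `|t| * D by rewrite mulr_ge0.
move: h1 h2 h3 h4 w2; set T := `|t|.
nra.
Qed.

Lemma sqrt_sum_sqr_dist (I : Type) (r : seq I) (P : pred I) (x y : I -> R) :
  `|Num.sqrt (\sum_(i <- r | P i) x i ^+ 2) -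
    Num.sqrt (\sum_(i <- r | P i) y i ^+ 2)| <=
  \sum_(i <- r | P i) `|x i - y i|.
Proof.
have /= H1 := sqrt_sum_sqr_le _ r P x y.
have /= := sqrt_sum_sqr_le _ r P y x.
under [X in _ <= _ + X -> _]eq_bigr do rewrite distrC.
move=> H2.
by rewrite ler_distlC; apply/andP; split; lra.
Qed.

Section wedge.
Variable n : nat.
Implicit Types u v : 'rV[R]_n.

Definition wedge_coord u v (p : 'I_n * 'I_n) : R :=
  u ord0 p.1 * v ord0 p.2 - u ord0 p.2 * v ord0 p.1.

Lemma wedge_normE u v : wedge_norm u v =
  Num.sqrt (\sum_(p : 'I_n * 'I_n | (p.1 < p.2)%N) wedge_coord u v p ^+ 2).
Proof. by rewrite /wedge_norm (pair_big_dep xpredT (fun j k : 'I_n => (j < k)%N)). Qed.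

Lemma wedge_norm_dist u v u' v' :
  `|wedge_norm u v - wedge_norm u' v'| <=
  \sum_(p : 'I_n * 'I_n | (p.1 < p.2)%N)
    `|wedge_coord u v p - wedge_coord u' v' p|.
Proof. by rewrite !wedge_normE; exact: sqrt_sum_sqr_dist. Qed.

Lemma wedge_normZ r u v : wedge_norm (r *: u) v = `|r| * wedge_norm u v.
Proof.
rewrite !wedge_normE -sqrtr_sqr -sqrtrM ?sqr_ge0// mulr_sumr.
by congr Num.sqrt; apply: eq_bigr => p _; rewrite /wedge_coord !mxE; ring.
Qed.

Lemma wedge_norm_continuous (T : topologicalType) (f g : T -> 'rV[R]_n) x :
  (forall j, {for x, continuous (fun y => f y ord0 j)}) ->
  (forall j, {for x, continuous (fun y => g y ord0 j)}) ->
  {for x, continuous (fun y => wedge_norm (f y) (g y))}.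
Proof.
move=> cf cg.
have -> : (fun y => wedge_norm (f y) (g y)) = Num.sqrt \o
  (fun y => \sum_(p : 'I_n * 'I_n | (p.1 < p.2)%N) wedge_coord (f y) (g y) p ^+ 2).
  by apply/funext => y; rewrite wedge_normE.
apply: continuous_comp; last exact: sqrt_continuous.
elim: (index_enum _) => [|p r IH]; rewrite /prop_for /continuous_at.
  by under eq_fun do rewrite big_nil; rewrite big_nil; exact: cvg_cst.
rewrite big_cons; under eq_fun do rewrite big_cons.
case: ifP => // _.
apply: cvgD; last exact: IH.
have H : wedge_coord (f y) (g y) p @[y --> x] --> wedge_coord (f x) (g x) p.
  by apply: cvgB; apply: cvgM; [exact: cf|exact: cg|exact: cf|exact: cg].
by rewrite expr2; under eq_fun do rewrite expr2; apply: cvgM; exact: H.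
Qed.

End wedge.

End wedge_norm_theory.

(** * Borel sets of the plane and the product sigma-algebra *)

Section plane_measurability.
Variable R : realType.
Local Notation G := (g_sigma_algebraType R.-ocitv.-measurable).

(** The product measure of [leb2], typed as a measure so that the general measure lemmas apply to
    it. *)
Definition plane_measure : {measure set (G * G)%type -> \bar R} :=
  (@lebesgue_measure R \x @lebesgue_measure R)%E.

(** An open set is the union of the open boxes with rational corners that it contains; these are
    countably many measurable rectangles. *)
Lemma open_measurable_prod (U : set (R * R)) : open U -> @measurable _ (G * G)%type U.
Proof.
move=> oU.
pose box (q : rat * rat * rat * rat) : set (R * R) :=
  [set` `]ratr q.1.1.1, ratr q.1.1.2[] `*` [set` `]ratr q.1.2, ratr q.2[].
have -> : U = \bigcup_q (if `[< box q `<=` U >] then box q else set0).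
  apply/seteqP; split=> [x Ux|x [q _]]; last by case: ifPn => // /asboolP; apply.
  have /nbhs_ballP[r /= r0 rU] : nbhs x U by apply: open_nbhs_nbhs.
  have lt1 (y : R) : y - r < y by rewrite ltrBlDr ltrDl.
  have lt2 (y : R) : y < y + r by rewrite ltrDl.
  have [q1 /[!in_itv]/= /andP[a1 b1]] := rat_in_itvoo (lt1 x.1).
  have [q2 /[!in_itv]/= /andP[a2 b2]] := rat_in_itvoo (lt2 x.1).
  have [q3 /[!in_itv]/= /andP[a3 b3]] := rat_in_itvoo (lt1 x.2).
  have [q4 /[!in_itv]/= /andP[a4 b4]] := rat_in_itvoo (lt2 x.2).
  exists (q1, q2, q3, q4) => //.
  rewrite ifT; last first.
    apply/asboolP => -[y1 y2] [/=]; rewrite !in_itv /= => /andP[c1 d1] /andP[c2 d2].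
    apply: rU; split; rewrite /ball /= ltr_norml /=; apply/andP; split; lra.
  by split; rewrite /= in_itv /=; apply/andP; split.
apply: countable_bigcupT_measurable => // q.
case: ifP => _; first by apply: measurableX; exact: measurable_itv.
exact: measurable0.
Qed.

Lemma closed_measurable_prod (U : set (R * R)) :
  closed U -> @measurable _ (G * G)%type U.
Proof.
move=> cU; rewrite -(setCK U); apply: measurableC; apply: open_measurable_prod.
exact: closed_openC.
Qed.

Lemma continuous_on_open_measurable (U : set (R * R)) (f : R * R -> R) :
  open U -> (forall x, U x -> {for x, continuous f}) ->
  @measurable_fun _ _ (G * G)%type _ U f.
Proof.
move=> oU cf mU; apply: (measurability _ (measurable_realfun.RGenOInfty.measurableE R)) => //.
move=> /= _ [_ [a ->] <-]; apply: open_measurable_prod.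
rewrite openE => x [Ux]; rewrite /= in_itv /= andbT => ax.
apply: filterI; first exact: open_nbhs_nbhs.
have /cvgrPdist_lt/(_ (f x - a)) := cf x Ux.
rewrite subr_gt0 => /(_ ax); apply: filterS => y /=.
rewrite in_itv /= andbT ltr_norml => /andP[_]; lra.
Qed.

End plane_measurability.

(** * Barycentric coordinates, compactness of triangles, null boundaries *)

Section triangle_topology.
Variable R : realType.
Local Notation G := (g_sigma_algebraType R.-ocitv.-measurable).
Implicit Types a b c z : R * R.

Definition tri_det a b c : R :=
  (b.1 - a.1) * (c.2 - a.2) - (b.2 - a.2) * (c.1 - a.1).

Lemma affine_continuous (p q r : R) :
  continuous (fun z : R * R => p * z.1 + q * z.2 + r).
Proof.
move=> z; apply: cvgD; last exact: cvg_cst.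
by apply: cvgD; apply: cvgM; try exact: cvg_cst; [exact: cvg_fst|exact: cvg_snd].
Qed.

Lemma plane_measureE (A : set (R * R)) :
  plane_measure R A = (\int[lebesgue_measure]_x lebesgue_measure (xsection A x))%E.
Proof. by []. Qed.

Lemma closed_line (p q r : R) : closed [set z : R * R | p * z.1 + q * z.2 + r = 0].
Proof.
apply: (@preimage_closed _ _ (fun z : R * R => p * z.1 + q * z.2 + r) [set 0]).
  by move=> z _; exact: affine_continuous.
exact: closed_eq.
Qed.

(** If [q] is nonzero every vertical section is a single point; otherwise the line is the product of
    a point and the real line. *)
Lemma plane_measure_line (p q r : R) : (p != 0) || (q != 0) ->
  plane_measure R [set z : R * R | p * z.1 + q * z.2 + r = 0] = 0%E.
Proof.
have [->|q0 _] := eqVneq q 0; last first.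
  rewrite plane_measureE integral0_eq// => x _.
  rewrite (_ : xsection _ _ = [set - (p * x + r) / q]) ?lebesgue_measure_set1//.
  apply/seteqP; split => [y|y ->]; rewrite /xsection /= inE /=.
    move=> E; have -> : - (p * x + r) = q * y by lra.
    by field.
  by field.
rewrite orbF => p0.
have -> : [set z : R * R | p * z.1 + 0 * z.2 + r = 0] = [set - r / p] `*` setT.
  apply/seteqP; split => [[x y] /= E|[x y] [/= -> _]].
    split => //=; have -> : - r = p * x by lra.
    by field.
  by field.
rewrite /plane_measure /= product_measure1E// (_ : _ [set - r / p] = 0%E) ?mul0e//.
exact: lebesgue_measure_set1.
Qed.

Lemma tri_det_sum a b c z :
  tri_det z b c + tri_det a z c + tri_det a b z = tri_det a b c.
Proof. by rewrite /tri_det; ring. Qed.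

Lemma tri_detE z b c : tri_det z b c =
  (b.2 - c.2) * z.1 + (c.1 - b.1) * z.2 + (b.1 * c.2 - b.2 * c.1).
Proof. rewrite /tri_det; ring. Qed.

Lemma tri_det_rot a b c : tri_det b c a = tri_det a b c.
Proof. rewrite /tri_det; ring. Qed.

Lemma tri_det_swap a b c : tri_det a c b = - tri_det a b c.
Proof. rewrite /tri_det; ring. Qed.

Lemma triangle_rot a b c : triangle b c a = triangle a b c.
Proof.
apply/seteqP; split => z [l1 [l2 [l3 [h1 h2 h3 h4 ->]]]].
  by exists l3, l1, l2; split => //; [lra|congr pair; lra].
by exists l2, l3, l1; split => //; [lra|congr pair; lra].
Qed.

Lemma triangle_swap a b c : triangle a c b = triangle a b c.
Proof.
by apply/seteqP; split => z [l1 [l2 [l3 [h1 h2 h3 h4 ->]]]];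
  exists l1, l3, l2; split => //; [lra|congr pair; lra|lra|congr pair; lra].
Qed.

(** The points with three positive barycentric coordinates. Strict affine inequalities make openness
    immediate, and dividing by [tri_det a b c] covers both orientations. *)
Definition open_triangle a b c : set (R * R) :=
  [set z | [/\ 0 < tri_det z b c / tri_det a b c, 0 < tri_det a z c / tri_det a b c &
     0 < tri_det a b z / tri_det a b c]].

Lemma open_triangle_open a b c : open (open_triangle a b c).
Proof.
have H (D : R) (p q : R * R) : open [set z | 0 < tri_det z p q / D].
  apply: (@open_comp _ _ (fun z => tri_det z p q / D) [set x | 0 < x]);
    last exact: open_gt.
  move=> z _; apply: cvgM; last exact: cvg_cst.
  rewrite tri_detE; under eq_fun do rewrite tri_detE; exact: affine_continuous.
have -> : open_triangle a b c = [set z | 0 < tri_det z b c / tri_det a b c] `&`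
    ([set z | 0 < tri_det z c a / tri_det a b c] `&`
     [set z | 0 < tri_det z a b / tri_det a b c]).
  apply/seteqP; split => z.
    move=> [? ? ?]; split => //=.
    by rewrite [tri_det z c a]tri_det_rot -[tri_det z a b]tri_det_rot.
  move=> [? []] /=.
  by rewrite [tri_det z c a]tri_det_rot -[tri_det z a b]tri_det_rot; split.
by apply: openI; [|apply: openI]; exact: H.
Qed.

Lemma open_triangle_sub a b c : tri_det a b c != 0 ->
  open_triangle a b c `<=` triangle a b c.
Proof.
move=> D0 z [z1 z2 z3].
exists (tri_det z b c / tri_det a b c), (tri_det a z c / tri_det a b c),
  (tri_det a b z / tri_det a b c).
split; try exact: ltW.
  by rewrite -!mulrDl tri_det_sum divff.
(* Cramer's rule for the barycentric coordinates, cleared of denominators. *)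
have E :
    z.1 * tri_det a b c =
      tri_det z b c * a.1 + tri_det a z c * b.1 + tri_det a b z * c.1 /\
    z.2 * tri_det a b c =
      tri_det z b c * a.2 + tri_det a z c * b.2 + tri_det a b z * c.2.
  by rewrite /tri_det; split; ring.
rewrite [LHS]surjective_pairing; congr pair; apply: (mulIf D0).
  by rewrite E.1; field.
by rewrite E.2; field.
Qed.

Lemma plane_measure_det0 a b c : tri_det a b c != 0 ->
  plane_measure R [set z | tri_det z b c = 0] = 0%E.
Proof.
move=> D0; under eq_set do rewrite tri_detE; apply: plane_measure_line.
rewrite -negb_and; apply: contra D0 => /andP[/eqP p0 /eqP q0].
rewrite tri_detE p0 q0; have -> : b.2 = c.2 by lra.
have -> : c.1 = b.1 by lra.
by apply/eqP; ring.
Qed.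

Lemma measurable_det0 b c :
  @measurable _ (G * G)%type [set z : R * R | tri_det z b c = 0].
Proof.
under eq_set do rewrite tri_detE; apply: closed_measurable_prod; exact: closed_line.
Qed.

Lemma triangle_compact a b c : compact (triangle a b c).
Proof.
(* The triangle is a continuous image of the unit square: [u.2] selects a point of the side from [b]
   to [c], and [u.1] the fraction of the way from [a] to it. At [a] itself the first parameter is
   [0], so the second is arbitrary and is taken to be [0]. *)
pose f (u : R * R) := (a.1 + u.1 * (b.1 - a.1 + u.2 * (c.1 - b.1)),
                       a.2 + u.1 * (b.2 - a.2 + u.2 * (c.2 - b.2))).
have -> : triangle a b c = f @` (`[0, 1] `*` `[0, 1]).
  apply/seteqP; split => z.
    move=> [l1 [l2 [l3 [h1 h2 h3 h4 ->]]]].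
    have [s0|s0] := eqVneq (l2 + l3) 0.
      have [e2 e3] : l2 = 0 /\ l3 = 0 by split; lra.
      exists (0, 0); first by split; rewrite /= in_itv /= lexx ler01.
      by rewrite /f /= e2 e3 (_ : l1 = 1); [congr pair; ring|lra].
    have s1 : 0 < l2 + l3 by rewrite lt0r s0 addr_ge0.
    exists (l2 + l3, l3 / (l2 + l3)).
      split; rewrite /= in_itv /=; apply/andP; split; [lra|lra|by rewrite divr_ge0// ltW|].
      by rewrite ler_pdivrMr//; lra.
    by rewrite /f /= (_ : l1 = 1 - l2 - l3); [congr pair; field|lra].
  move=> [[u v] [/=]]; rewrite !in_itv /= => /andP[u0 u1] /andP[v0 v1] <-.
  exists (1 - u), (u * (1 - v)), (u * v); split; rewrite ?mulr_ge0 ?subr_ge0//; first by ring.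
  by rewrite /f /=; congr pair; ring.
apply: continuous_compact; last by apply: compact_setX; exact: segment_compact.
apply: continuous_subspaceT => u.
have cf (p q r : R) : continuous (fun u : R * R => p + u.1 * (q + u.2 * r)).
  move=> v; apply: cvgD; first exact: cvg_cst.
  apply: cvgM; first exact: cvg_fst.
  apply: cvgD; first exact: cvg_cst.
  by apply: cvgM; [exact: cvg_snd|exact: cvg_cst].
exact: (cvg_pair (cf _ _ _ u) (cf _ _ _ u)).
Qed.

Lemma measurable_triangle a b c : @measurable _ (G * G)%type (triangle a b c).
Proof.
apply: closed_measurable_prod; apply: compact_closed; last exact: triangle_compact.
exact: norm_hausdorff.
Qed.

(** A point of the triangle on none of the three side lines has positive barycentric coordinates,
    hence is interior. So the boundary lies in three null lines. *)
Lemma plane_measure_triangle_boundary a b c : tri_det a b c != 0 ->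
  plane_measure R (triangle a b c `\` interior (triangle a b c)) = 0%E.
Proof.
move=> D0.
pose N := [set z | tri_det z b c = 0] `|`
  ([set z | tri_det z c a = 0] `|` [set z | tri_det z a b = 0]).
have mN : @measurable _ (G * G)%type N by repeat apply: measurableU; exact: measurable_det0.
have N0 : plane_measure R N = 0%E.
  have z1 := plane_measure_det0 _ _ _ D0.
  have z2 : plane_measure R [set z | tri_det z c a = 0] = 0%E.
    by apply: (plane_measure_det0 b); rewrite tri_det_rot.
  have z3 : plane_measure R [set z | tri_det z a b = 0] = 0%E.
    by apply: (plane_measure_det0 c); rewrite -tri_det_rot.
  have m1 := measurable_det0.
  rewrite /N; apply: (etrans (measureU0 _ _ _)) => //; first exact: measurableU.
  exact: (etrans (measureU0 _ _ _)).
apply: (@subset_measure0 _ _ _ (plane_measure R) _ N) => //.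
  apply: measurableD; first exact: measurable_triangle.
  by apply: open_measurable_prod; exact: open_interior.
move=> z [Tz nIz]; apply: contrapT => nN; apply: nIz.
have H : open_triangle a b c z.
  move: Tz => [l1 [l2 [l3 [h1 h2 h3 h4 zE]]]].
  have l1E : l1 = 1 - l2 - l3 by lra.
  have d1 : tri_det z b c = l1 * tri_det a b c by rewrite /tri_det zE l1E /=; ring.
  have d2 : tri_det a z c = l2 * tri_det a b c by rewrite /tri_det zE l1E /=; ring.
  have d3 : tri_det a b z = l3 * tri_det a b c by rewrite /tri_det zE l1E /=; ring.
  move: nN; rewrite /N /= [tri_det z c a]tri_det_rot -[tri_det z a b]tri_det_rot d1 d2 d3.
  move=> /not_orP[/eqP n1 /not_orP[/eqP n2 /eqP n3]].
  rewrite /open_triangle /= d1 d2 d3.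
  move: n1 n2 n3; rewrite !mulf_eq0 !(negbTE D0) !orbF => n1 n2 n3.
  by rewrite !mulfK// !lt0r n1 n2 n3; split.
apply: (@filterS _ _ _ _ _ (@open_triangle_sub _ _ _ D0)).
by apply: open_nbhs_nbhs; split => //; exact: open_triangle_open.
Qed.

End triangle_topology.

Arguments tri_det {R} a b c.

(** * The area of a triangle *)

Section triangle_area.
Variable R : realType.
Implicit Types a b c z : R * R.

Lemma integral_affine (p q r k : R) : p < q ->
  (\int[lebesgue_measure]_(x in `[p, q]) (k * (x - r))%:E =
   (k / 2 * ((q - r) ^+ 2 - (p - r) ^+ 2))%:E)%E.
Proof.
move=> pq; pose F (x : R) := k / 2 * ((x - r) ^+ 2).
have dF (x : R) : is_derive x 1 F (k * (x - r)).
  by apply: is_derive_eq; rewrite /GRing.scale /=; field.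
have cF : continuous F.
  move=> x; apply: differentiable_continuous; apply/derivable1_diffP.
  exact: (@ex_derive _ _ _ _ _ _ _ (dF x)).
rewrite (@continuous_FTC2 _ (fun x => k * (x - r)) F)//.
- by rewrite /F -EFinB mulrBr.
- apply: continuous_subspaceT => x; apply: cvgM; first exact: cvg_cst.
  by apply: cvgB; [exact: cvg_id|exact: cvg_cst].
- split.
  + by move=> x _; exact: (@ex_derive _ _ _ _ _ _ _ (dF x)).
  + exact: cvg_at_right_filter (cF p).
  + exact: cvg_at_left_filter (cF q).
- by move=> x _; rewrite derive1E; exact: (@derive_val _ _ _ _ _ _ _ (dF x)).
Qed.

(** The section is the vertical side shrunk towards [a] by the factor [(x - a.1) / (x0 - a.1)], so
    its length is affine in [x]. *)
Lemma xsection_vertical_triangle a (x0 y0 y1 x : R) : x0 != a.1 -> y0 <= y1 ->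
  0 <= (x - a.1) / (x0 - a.1) <= 1 ->
  xsection (triangle a (x0, y0) (x0, y1)) x =
    [set` `[a.2 + (x - a.1) / (x0 - a.1) * (y0 - a.2),
            a.2 + (x - a.1) / (x0 - a.1) * (y1 - a.2)]].
Proof.
move=> xa yy; set u := _ / _ => /andP[u0 u1].
have xE : x = a.1 + u * (x0 - a.1) by rewrite /u; field; rewrite subr_eq0.
apply/seteqP; split => y; rewrite /xsection /= inE /= in_itv /=.
  move=> [l1 [l2 [l3 [h1 h2 h3 h4 [E1 E2]]]]].
  have ul : u = l2 + l3.
    apply: (@mulIf _ (x0 - a.1)); first by rewrite subr_eq0.
    rewrite (_ : l1 = 1 - l2 - l3) in E1; lra.
  rewrite E2 (_ : l1 = 1 - u); last lra.
  have ? : l3 * y0 <= l3 * y1 by rewrite ler_wpM2l.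
  have ? : l2 * y0 <= l2 * y1 by rewrite ler_wpM2l.
  by apply/andP; split; rewrite ul; lra.
move=> /andP[h1 h2].
(* A section reduced to one point is treated apart, since the position [t] along it is then
   undefined. *)
have [E|ne] := eqVneq (u * (y1 - y0)) 0.
  exists (1 - u), u, 0; split => //; [lra|lra|].
  rewrite xE; congr pair => /=; lra.
have P : 0 < u * (y1 - y0) by rewrite lt0r ne mulr_ge0// subr_ge0.
pose t := (y - (a.2 + u * (y0 - a.2))) / (u * (y1 - y0)).
have t0 : 0 <= t by rewrite divr_ge0//; lra.
have t1 : t <= 1 by rewrite ler_pdivrMr//; lra.
exists (1 - u), (u * (1 - t)), (u * t).
split; [lra|by rewrite mulr_ge0// subr_ge0|by rewrite mulr_ge0|ring|].
have yE : y = a.2 + u * (y0 - a.2) + t * (u * (y1 - y0)) by rewrite /t divfK//; ring.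
by rewrite xE {1}yE; congr pair => /=; ring.
Qed.

Lemma measure_vertical_triangle a (x0 y0 y1 : R) :
  plane_measure R (triangle a (x0, y0) (x0, y1)) = (`|x0 - a.1| * `|y1 - y0| / 2)%:E.
Proof.
wlog yy : y0 y1 / y0 <= y1 => [H|].
  have [|/ltW] := leP y0 y1; first exact: H.
  by move=> /H; rewrite triangle_swap [`|y0 - y1|]distrC.
have [E|xa] := eqVneq x0 a.1.
  rewrite E subrr normr0 !mul0r.
  apply: (@subset_measure0 _ _ _ (plane_measure R) _
    [set z | 1 * z.1 + 0 * z.2 + (- a.1) = 0]).
  - exact: measurable_triangle.
  - apply: closed_measurable_prod; exact: closed_line.
  - move=> z [l1 [l2 [l3 [h1 h2 h3 h4 ->]]]] /=.
    rewrite (_ : l1 = 1 - l2 - l3); [ring|lra].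
  - by apply: plane_measure_line; rewrite oner_neq0.
rewrite plane_measureE.
rewrite [`|y1 - y0|]ger0_norm ?subr_ge0//.
pose k := (y1 - y0) / (x0 - a.1).
(* The apex may lie on either side of the vertical side; [m] and [M] treat both cases together. *)
pose m := Num.min a.1 x0; pose M := Num.max a.1 x0.
have mM : m < M by rewrite /m /M; case: (ltgtP a.1 x0) xa.
have uE x : (0 <= (x - a.1) / (x0 - a.1) <= 1) = (m <= x <= M).
  rewrite /m /M; case: (ltgtP a.1 x0) xa => // h _.
    by rewrite pmulr_lge0 ?invr_gt0 ?subr_gt0// ler_pdivrMr ?subr_gt0// mul1r lerD2r subr_ge0.
  rewrite nmulr_lge0 ?invr_lt0 ?subr_lt0// ler_ndivrMr ?subr_lt0// mul1r lerD2r subr_le0.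
  by rewrite andbC.
transitivity (\int[lebesgue_measure]_(x in `[m, M]) (k * (x - a.1))%:E)%E.
  rewrite [RHS]integral_mkcond; apply: eq_integral => x _.
  rewrite patchE; case: ifPn => xmM.
    have {}xmM : m <= x <= M by move: xmM; rewrite inE /= in_itv.
    rewrite xsection_vertical_triangle ?uE//.
    move: xmM; rewrite -uE => /andP[u0 _].
    rewrite /= lebesgue_measure_itv /= lte_fin ltrD2l.
    have -> : k * (x - a.1) = (x - a.1) / (x0 - a.1) * (y1 - y0) by rewrite /k; ring.
    set u := _ / _ in u0 *.
    case: ltP => [_|le]; first by rewrite -EFinD; congr EFin; ring.
    have : 0 <= u * (y1 - y0) by rewrite mulr_ge0// subr_ge0.
    by move=> ?; congr EFin; lra.
  rewrite (_ : xsection _ _ = set0) ?measure0//.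
  apply/seteqP; split => // y; rewrite /xsection /= inE /=.
  move=> [l1 [l2 [l3 [h1 h2 h3 h4 [E1 E2]]]]].
  move/negP : xmM; apply; rewrite inE /= in_itv /= -uE.
  rewrite (_ : x - a.1 = (l2 + l3) * (x0 - a.1)); last first.
    by rewrite E1 (_ : l1 = 1 - l2 - l3); [ring|lra].
  rewrite mulfK ?subr_eq0//; apply/andP; split; lra.
rewrite integral_affine// /k /m /M; congr EFin.
case: (ltgtP a.1 x0) xa => // h _.
  by rewrite gtr0_norm ?subr_gt0//; field; rewrite subr_eq0 gt_eqF.
by rewrite ltr0_norm ?subr_lt0//; field; rewrite subr_eq0 lt_eqF.
Qed.

(** Comparing [l3 * (1 - t)] with [l1 * t] decides on which side of the segment from [b] to [d] a
    point lies. The new weights follow by eliminating [c] or [a] in favour of [d]. *)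
Lemma triangle_split a b c t : 0 <= t <= 1 ->
  let d := ((1 - t) * a.1 + t * c.1, (1 - t) * a.2 + t * c.2) in
  triangle a b c = triangle a b d `|` triangle d b c.
Proof.
move=> /andP[t0 t1] d; apply/seteqP; split => z.
  move=> [l1 [l2 [l3 [h1 h2 h3 h4 ->]]]].
  have [h|h] := leP (l3 * (1 - t)) (l1 * t).
    left; have [tE|tn] := eqVneq t 0.
      exists l1, l2, 0; split => //; first by move: h; rewrite tE; lra.
      have -> : l3 = 0 by move: h; rewrite tE; lra.
      by congr pair; ring.
    have tp : 0 < t by rewrite lt0r tn.
    have e : l1 - l3 / t * (1 - t) = (l1 * t - l3 * (1 - t)) / t by field.
    exists (l1 - l3 / t * (1 - t)), l2, (l3 / t); split => //.
    + by rewrite e divr_ge0// subr_ge0.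
    + by rewrite divr_ge0.
    + by rewrite -[RHS]h4; field.
    + by rewrite /d /=; congr pair; field.
  have tp : 0 < 1 - t.
    rewrite lt0r subr_ge0 t1 andbT; apply/eqP => E; move: h; rewrite E mulr0.
    by rewrite ltNge mulr_ge0.
  right.
  have e : l3 - l1 / (1 - t) * t = (l3 * (1 - t) - l1 * t) / (1 - t) by field; lra.
  exists (l1 / (1 - t)), l2, (l3 - l1 / (1 - t) * t); split => //.
  + by rewrite divr_ge0// ltW.
  + by rewrite e divr_ge0//; lra.
  + by rewrite -[RHS]h4; field; lra.
  + by rewrite /d /=; congr pair; field; lra.
move=> [] [l1 [l2 [l3 [h1 h2 h3 h4 ->]]]].
  exists (l1 + l3 * (1 - t)), l2, (l3 * t).
  split => //; [by rewrite addr_ge0// mulr_ge0// subr_ge0|by rewrite mulr_ge0|lra|].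
  by rewrite /d /=; congr pair; ring.
exists (l1 * (1 - t)), l2, (l3 + l1 * t).
split => //; [by rewrite mulr_ge0// subr_ge0|by rewrite addr_ge0// mulr_ge0|lra|].
by rewrite /d /=; congr pair; ring.
Qed.

(** With the vertices sorted by abscissa, the vertical line through the middle one cuts the triangle
    into two triangles with a common vertical side. *)
Lemma measure_triangle a b c : tri_det a b c != 0 ->
  plane_measure R (triangle a b c) = (`|tri_det a b c| / 2)%:E.
Proof.
pose P a b c := tri_det a b c != 0 ->
  plane_measure R (triangle a b c) = (`|tri_det a b c| / 2)%:E.
rewrite -/(P a b c).
have rot a' b' c' : P a' b' c' -> P b' c' a'.
  by rewrite /P (tri_det_rot _ a') (triangle_rot _ a').
have swap a' b' c' : P a' b' c' -> P a' c' b'.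
  by rewrite /P tri_det_swap triangle_swap normrN oppr_eq0.
(* Rotations and swaps generate all permutations of the vertices, so the sorted case suffices. *)
suff H a' b' c' : a'.1 <= b'.1 -> b'.1 <= c'.1 -> P a' b' c'.
  clearbody P.
  have [ab|/ltW ab] := leP a.1 b.1; have [bc|/ltW bc] := leP b.1 c.1;
    have [ac|/ltW ac] := leP a.1 c.1.
  - exact: H.
  - exact: H.
  - by apply: swap; exact: H.
  - by apply: rot; exact: H.
  - by apply/rot/rot/swap; exact: H.
  - by apply/rot/rot; exact: H.
  - by apply: rot; apply: swap; exact: H.
  - by apply: rot; apply: swap; exact: H.
move=> {a b c} ab bc; move: a' b' c' ab bc.
move=> [a1 a2] [b1 b2] [c1 c2] /= ab bc; rewrite /P => D0.
have ac : a1 < c1.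
  rewrite lt_neqAle (le_trans ab bc) andbT; apply: contra D0 => /eqP E.
  have E' : b1 = a1 by lra.
  by rewrite /tri_det /= E' -E; apply/eqP; ring.
have ca0 : c1 - a1 != 0 by rewrite subr_eq0 gt_eqF.
pose t := (b1 - a1) / (c1 - a1).
have t01 : 0 <= t <= 1.
  by rewrite divr_ge0 ?subr_ge0 ?(ltW ac)//= ler_pdivrMr ?subr_gt0// mul1r lerD2r.
pose d2 := (1 - t) * a2 + t * c2.
have dE : (1 - t) * a1 + t * c1 = b1.
  by rewrite (_ : _ + _ = a1 + t * (c1 - a1)); [rewrite divfK//; ring|ring].
have := @triangle_split (a1, a2) (b1, b2) (c1, c2) t t01; rewrite /= dE -/d2 => ->.
have m1 := measurable_triangle R (a1, a2) (b1, b2) (b1, d2).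
have m2 := measurable_triangle R (b1, d2) (b1, b2) (c1, c2).
have M1 := @measure_vertical_triangle (a1, a2) b1 b2 d2.
have M2 : plane_measure R (triangle (b1, d2) (b1, b2) (c1, c2)) =
    (`|b1 - c1| * `|b2 - d2| / 2)%:E.
  by rewrite -triangle_rot -triangle_rot (measure_vertical_triangle (c1, c2)).
(* The two pieces meet only on the vertical line with abscissa [b1], which is null. *)
have I0 : plane_measure R (triangle (a1, a2) (b1, b2) (b1, d2) `&`
    triangle (b1, d2) (b1, b2) (c1, c2)) = 0%E.
  apply: (@subset_measure0 _ _ _ (plane_measure R) _
    [set z | 1 * z.1 + 0 * z.2 + (- b1) = 0]).
  - exact: measurableI.
  - apply: closed_measurable_prod; exact: closed_line.
  - move=> z [[l1 [l2 [l3 [h1 h2 h3 h4 ->]]]] [k1 [k2 [k3 [g1 g2 g3 g4 [/= E _]]]]]].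
    have H1 : l1 * a1 <= l1 * b1 by rewrite ler_wpM2l.
    have H2 : k3 * b1 <= k3 * c1 by rewrite ler_wpM2l.
    have l1E : l1 = 1 - l2 - l3 by lra.
    have k3E : k1 = 1 - k2 - k3 by lra.
    rewrite /=; move: E H1 H2; rewrite l1E k3E; lra.
  - by apply: plane_measure_line; rewrite oner_neq0.
apply: (etrans (measureUfinr _ _ _)) => //; first by rewrite M2 ltry.
rewrite I0 sube0 M1 M2 -EFinD; congr EFin.
rewrite [`|b1 - c1|]distrC [`|b2 - d2|]distrC /=.
rewrite (ger0_norm (_ : 0 <= b1 - a1)) ?subr_ge0// (ger0_norm (_ : 0 <= c1 - b1)) ?subr_ge0//.
have -> : tri_det (a1, a2) (b1, b2) (c1, c2) = (c1 - a1) * (d2 - b2).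
  by rewrite /tri_det /d2 /t /=; field.
rewrite normrM (gtr0_norm (_ : 0 < c1 - a1)) ?subr_gt0//.
ring.
Qed.

End triangle_area.

(** * Integrals and areas over a partition into triangles *)

Section triangle_partitions.
Variable R : realType.
Local Notation G := (g_sigma_algebraType R.-ocitv.-measurable).
Local Notation G2 := (G * G)%type.
Local Notation mu := (plane_measure R).

Lemma integral_near_const d (T : measurableType d) (mu : {measure set T -> \bar R})
    (D : set T) (f : T -> R) (m c e : R) :
  measurable D -> measurable_fun D f -> mu D = m%:E ->
  (forall z, D z -> 0 <= f z) -> 0 <= c -> 0 <= e ->
  (forall z, D z -> `|f z - c| <= e) ->
  exists2 r, (\int[mu]_(z in D) (f z)%:E)%E = r%:E & `|r - c * m| <= e * m.
Proof.
move=> mD mf Dm f0 c0 e0 fce.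
have mEf : measurable_fun D (EFin \o f) by exact/measurable_EFinP.
have up : (\int[mu]_(z in D) (f z)%:E <= ((c + e) * m)%:E)%E.
  rewrite EFinM -Dm -integral_cst//; apply: ge0_le_integral => //.
  move=> z Dz; rewrite /cst lee_fin.
  by move: (fce z Dz); rewrite ler_distl => /andP[] *; lra.
(* The lower bound is kept as [c <= f + e]: [c - e] may be negative, and only integrals of
   nonnegative functions are compared. *)
have lo : ((c * m)%:E <= \int[mu]_(z in D) (f z)%:E + (e * m)%:E)%E.
  rewrite !EFinM -Dm -!integral_cst// -ge0_integralD//.
  apply: ge0_le_integral => //.
  - exact: emeasurable_funD.
  - move=> z Dz; rewrite /cst -EFinD lee_fin.
    by move: (fce z Dz); rewrite ler_distl => /andP[] *; lra.
have ge0 : (0 <= \int[mu]_(z in D) (f z)%:E)%E.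
  by apply: integral_ge0 => z /f0; rewrite lee_fin.
move: up lo ge0; case: (integral _ _ _) => [r| |] //.
rewrite -EFinD !lee_fin => up lo _; exists r => //.
by rewrite ler_distl; apply/andP; split; lra.
Qed.

Lemma measure_bigsetU0 d (T : measurableType d) (mu : {measure set T -> \bar R})
    (I : eqType) (s : seq I) (F : I -> set T) :
  (forall i, i \in s -> measurable (F i)) -> (forall i, i \in s -> mu (F i) = 0%E) ->
  measurable (\big[setU/set0]_(i <- s) F i) /\ mu (\big[setU/set0]_(i <- s) F i) = 0%E.
Proof.
elim: s => [|i s IH] mF F0.
  by rewrite big_nil measure0; split => //; exact: measurable0.
rewrite big_cons.
have tl j : j \in s -> j \in i :: s by move=> js; rewrite inE js orbT.
have [m1 m2] := IH (fun j js => mF j (tl j js)) (fun j js => F0 j (tl j js)).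
have mi := mF i (mem_head _ _); split; first exact: measurableU.
by rewrite measureU0//; exact: F0 (mem_head _ _).
Qed.

Lemma open_interior_measurable (A : set (R * R)) : @measurable _ G2 (interior A).
Proof. by apply: open_measurable_prod; exact: open_interior. Qed.

Lemma measure_interior_triangle (a b c : R * R) : tri_det a b c != 0 ->
  mu (interior (triangle a b c)) = (`|tri_det a b c| / 2)%:E.
Proof.
move=> D0; rewrite -measure_triangle//.
rewrite -[in RHS](setDUK (@interior_subset _ (triangle a b c))).
apply/esym; apply: (etrans (measureU0 _ _ _)) => //.
- exact: open_interior_measurable.
- by apply: measurableD; [exact: measurable_triangle|exact: open_interior_measurable].
- exact: plane_measure_triangle_boundary.
Qed.

(** The open interiors are disjoint, and what they leave of [P] lies in finitely many triangle
    boundaries, which are null. *)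
Lemma integral_partition (Pi : seq ((R * R) * (R * R) * (R * R))) (P : set (R * R))
    (f : G2 -> \bar R) :
  (forall t, t \in Pi -> Defs.nondegenerate t.1.1 t.1.2 t.2) ->
  (forall i j : nat, (i < size Pi)%N -> (j < size Pi)%N -> i <> j ->
     interior (tri_of (nth (0, 0, 0) Pi i)) `&`
     interior (tri_of (nth (0, 0, 0) Pi j)) = set0) ->
  P = \bigcup_(t in [set t | t \in Pi]) tri_of t ->
  @measurable _ G2 P -> measurable_fun (P : set G2) f -> (forall z, P z -> 0 <= f z)%E ->
  (\int[mu]_(z in P) f z = \sum_(t <- Pi) \int[mu]_(z in interior (tri_of t)) f z)%E.
Proof.
move=> ndg dis PE mP mf f0.
(* The pieces are indexed by position in the list, as in the disjointness hypothesis. *)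
pose F i : set G2 := interior (tri_of (nth (0, 0, 0) Pi i)).
pose s := iota 0 (size Pi).
pose D : set G2 := \big[setU/set0]_(i <- s) F i.
have DE : D = \bigcup_(i in [set i | (i < size Pi)%N]) F i.
  rewrite /D -bigcup_seq; congr bigcup.
  by apply/seteqP; split => i /=; rewrite mem_iota.
have mF i : measurable (F i) by exact: open_interior_measurable.
have DP : D `<=` P.
  rewrite DE PE => z [i /= iPi Fz]; exists (nth (0, 0, 0) Pi i); first exact: mem_nth.
  exact: interior_subset.
have mD : measurable D by exact: bigsetU_measurable.
have PD0 : mu (P `\` D) = 0%E.
  have [|t tPi|mN N0] := @measure_bigsetU0 _ _ mu _ Pi
    (fun t => tri_of t `\` interior (tri_of t)).
  - move=> t _; apply: measurableD; first exact: measurable_triangle.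
    exact: open_interior_measurable.
  - by apply: plane_measure_triangle_boundary; exact: ndg.
  apply: (@subset_measure0 _ _ _ mu _ _ _ _ _ N0) => //; first exact: measurableD.
  rewrite PE -bigcup_seq => z [[t /= tPi tz] nD]; exists t => //.
  split => // Iz; apply: nD.
  rewrite DE; exists (index t Pi); first by rewrite /= index_mem.
  by rewrite /F nth_index.
rewrite (ge0_negligible_integral (measurableD mP mD) mP mf f0 PD0).
have -> : P `\` (P `\` D) = D by rewrite setDD; apply/setIidr.
rewrite [LHS]ge0_integral_bigsetU//.
- by rewrite [RHS](big_nth (0, 0, 0)) /index_iota subn0.
- exact: iota_uniq.
- apply/trivIsetP => i j /=; rewrite !mem_iota /= !add0n => iP jP /eqP ij.
  exact: dis.
- exact: measurable_funS mf.
- by move=> z /DP; exact: f0.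
Qed.

(** The case of integrand [1]; it lets errors proportional to the areas of the triangles add up to a
    multiple of the area of [P]. *)
Lemma measure_partition (Pi : seq ((R * R) * (R * R) * (R * R))) (P : set (R * R)) :
  (forall t, t \in Pi -> Defs.nondegenerate t.1.1 t.1.2 t.2) ->
  (forall i j : nat, (i < size Pi)%N -> (j < size Pi)%N -> i <> j ->
     interior (tri_of (nth (0, 0, 0) Pi i)) `&`
     interior (tri_of (nth (0, 0, 0) Pi j)) = set0) ->
  P = \bigcup_(t in [set t | t \in Pi]) tri_of t -> @measurable _ G2 P ->
  (mu P = (\sum_(t <- Pi) `|tri_det t.1.1 t.1.2 t.2| / 2)%:E)%E.
Proof.
move=> ndg dis PE mP.
have := @integral_partition Pi P (cst 1%E) ndg dis PE mP.
rewrite integral_cst// mul1e => -> //.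
rewrite -sumEFin !big_seq; apply: eq_bigr => t /ndg nt.
rewrite integral_cst ?mul1e ?measure_interior_triangle//; exact: open_interior_measurable.
Qed.

Lemma polygon_compact_finite (P : set (R * R)) : compact_polygon P ->
  [/\ compact P, @measurable _ G2 P & (mu P < +oo)%E].
Proof.
move=> [ts [_ + ->]]; elim: ts => [_|t ts IH /= /andP[/asboolP nt /IH[cT mT fT]]].
  rewrite (_ : [set t | t \in [::]] = set0); last by apply/seteqP; split.
  rewrite bigcup_set0 measure0; split => //; exact: compact0.
rewrite (_ : [set u | u \in t :: ts] = t |` [set u | u \in ts]); last first.
  apply/seteqP; split => u /=; first by rewrite inE => /orP[/eqP|]; [left|right].
  by rewrite inE => -[->|->]; rewrite ?eqxx ?orbT.
rewrite bigcup_setU1.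
have mt := measurable_triangle R t.1.1 t.1.2 t.2.
split; first by apply: compactU => //; exact: triangle_compact.
  exact: measurableU.
apply: (le_lt_trans (measureU2 _ mt mT)).
apply: lte_add_pinfty => //.
apply: (le_lt_trans (_ : _ <= (`|tri_det t.1.1 t.1.2 t.2| / 2)%:E)%E).
  by rewrite -measure_triangle.
exact: ltry.
Qed.

End triangle_partitions.

(** * The diagonals of the mirror kite and the estimate for one term *)

Section mirror_estimate.
Variable R : realType.
Implicit Types a b c : R * R.

Lemma coord_dist2 a b : `|a.1 - b.1| <= dist2 a b /\ `|a.2 - b.2| <= dist2 a b.
Proof.
by split; rewrite -sqrtr_sqr ler_wsqrtr// ?lerDl ?lerDr sqr_ge0.
Qed.

Lemma dist2_ball a b d : dist2 a b < d -> ball a d b.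
Proof. by move=> h; have [? ?] := coord_dist2 a b; split; exact: le_lt_trans h. Qed.

Lemma dist2C a b : dist2 a b = dist2 b a.
Proof. by rewrite /dist2; congr Num.sqrt; ring. Qed.

Lemma tri_det_base a b c : tri_det a b c != 0 ->
  0 < (c.1 - b.1) ^+ 2 + (c.2 - b.2) ^+ 2.
Proof.
move=> D0; rewrite lt0r addr_ge0 ?sqr_ge0// andbT; apply: contra D0.
rewrite paddr_eq0 ?sqr_ge0// !sqrf_eq0 => /andP[/eqP E1 /eqP E2].
have -> : tri_det a b c = (b.1 - a.1) * (c.2 - b.2) - (b.2 - a.2) * (c.1 - b.1).
  by rewrite /tri_det; ring.
by rewrite E1 E2 !mulr0 subrr.
Qed.

(** The vector from [a] to its mirror vertex is [c - b] turned clockwise by a right angle and scaled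
    by twice the determinant over the squared length of the base. *)
Lemma mirror_sub a b c : tri_det a b c != 0 ->
  let q := (c.1 - b.1) ^+ 2 + (c.2 - b.2) ^+ 2 in
  (mirror a b c).1 - a.1 = 2 * tri_det a b c / q * (c.2 - b.2) /\
  (mirror a b c).2 - a.2 = - (2 * tri_det a b c / q * (c.1 - b.1)).
Proof.
move=> D0 q; have /lt0r_neq0 q0 := tri_det_base _ _ _ D0.
by rewrite /mirror /proj_line /proj_param /= -/q /tri_det; split; rewrite /q; field.
Qed.

(** Reflection is an isometry fixing [b]. Hence the mirror vertex stays in the small ball around [b]
    that contains [a]. *)
Lemma dist2_mirror a b c : tri_det a b c != 0 ->
  dist2 (mirror a b c) b = dist2 a b.
Proof.
move=> D0; have [m1 m2] := mirror_sub _ _ _ D0.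
have /lt0r_neq0 q0 := tri_det_base _ _ _ D0.
rewrite /dist2; congr Num.sqrt.
have -> : (mirror a b c).1 = a.1 + ((mirror a b c).1 - a.1) by ring.
have -> : (mirror a b c).2 = a.2 + ((mirror a b c).2 - a.2) by ring.
by rewrite m1 m2 /tri_det; field.
Qed.

(* Orthogonality of the two diagonals keeps the product of their lengths
   comparable to the area. *)
Lemma mirror_cross a b c : tri_det a b c != 0 ->
  let n := ((mirror a b c).1 - a.1, (mirror a b c).2 - a.2) in
  let t := (c.1 - b.1, c.2 - b.2) in
  n.1 * t.2 - n.2 * t.1 = 2 * tri_det a b c /\
  (`|n.1| + `|n.2|) * (`|t.1| + `|t.2|) <= 4 * `|tri_det a b c|.
Proof.
move=> D0; have [m1 m2] := mirror_sub _ _ _ D0.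
have q0 := tri_det_base _ _ _ D0.
move: m1 m2 q0 => /=; set n1 := (mirror _ _ _).1 - _; set n2 := (mirror _ _ _).2 - _.
set t1 := c.1 - b.1; set t2 := c.2 - b.2; set D := tri_det _ _ _.
move=> -> -> q0; have q1 := lt0r_neq0 q0; split; first by field.
rewrite normrN !normrM !normfV (gtr0_norm q0) ger0_norm//.
rewrite [leLHS](_ : _ = 2 * `|D| / (t1 ^+ 2 + t2 ^+ 2) * (`|t1| + `|t2|) ^+ 2);
  last by field.
rewrite mulrAC ler_pdivrMr//.
rewrite [leRHS](_ : _ = 2 * `|D| * (2 * (t1 ^+ 2 + t2 ^+ 2))); last by ring.
rewrite ler_wpM2l ?mulr_ge0//.
have -> : t1 ^+ 2 = `|t1| ^+ 2 by rewrite real_normK ?num_real.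
have -> : t2 ^+ 2 = `|t2| ^+ 2 by rewrite real_normK ?num_real.
have := sqr_ge0 (`|t1| - `|t2|).
by move: `|t1| `|t2| => x y; rewrite !expr2; lra.
Qed.

(** Without the remainders the difference of products is exactly [(N1 * T2 - N2 * T1) * (Aj * Bk -
    Ak * Bj)]. The remainders change each of the two products by at most [(2 * M + 1) * e] times the
    product of the lengths. *)
Lemma cross_perturbation (N1 N2 T1 T2 Aj Ak Bj Bk rj rk tj tk M e : R) :
  0 <= e -> e <= 1 ->
  `|Aj| <= M -> `|Ak| <= M -> `|Bj| <= M -> `|Bk| <= M ->
  `|rj| <= e * (`|N1| + `|N2|) -> `|rk| <= e * (`|N1| + `|N2|) ->
  `|tj| <= e * (`|T1| + `|T2|) -> `|tk| <= e * (`|T1| + `|T2|) ->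
  `|((N1 * Aj + N2 * Bj + rj) * (T1 * Ak + T2 * Bk + tk) -
     (N1 * Ak + N2 * Bk + rk) * (T1 * Aj + T2 * Bj + tj)) -
    (N1 * T2 - N2 * T1) * (Aj * Bk - Ak * Bj)| <=
  2 * (2 * M + 1) * e * ((`|N1| + `|N2|) * (`|T1| + `|T2|)).
Proof.
move=> e0 e1 hAj hAk hBj hBk hrj hrk htj htk.
have lin (x y A B : R) : `|A| <= M -> `|B| <= M ->
    `|x * A + y * B| <= M * (`|x| + `|y|).
  move=> hA hB; rewrite (le_trans (ler_normD _ _))// !normrM mulrDr.
  by rewrite lerD// mulrC ler_wpM2r.
set n := `|N1| + `|N2| in hrj hrk *; set t := `|T1| + `|T2| in htj htk *.
have n0 : 0 <= n by rewrite addr_ge0.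
have t0 : 0 <= t by rewrite addr_ge0.
have half (Aj' Bj' Ak' Bk' r' t' : R) :
    `|Aj'| <= M -> `|Bj'| <= M -> `|Ak'| <= M -> `|Bk'| <= M ->
    `|r'| <= e * n -> `|t'| <= e * t ->
    `|(N1 * Aj' + N2 * Bj' + r') * (T1 * Ak' + T2 * Bk' + t') -
      (N1 * Aj' + N2 * Bj') * (T1 * Ak' + T2 * Bk')| <= (2 * M + 1) * e * (n * t).
  move=> h1 h2 h3 h4 hr ht.
  have l1 := lin N1 N2 _ _ h1 h2; have l2 := lin T1 T2 _ _ h3 h4.
  move: l1 l2; rewrite -/n -/t; move: (N1 * _ + _) (T1 * _ + _) => X Y hX hY.
  rewrite [X in `|X|](_ : _ = X * t' + r' * Y + r' * t'); last by ring.
  rewrite (le_trans (ler_normD _ _))// (le_trans (lerD (ler_normD _ _) (lexx _)))//.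
  rewrite !normrM.
  (* The first two error terms contribute [M] each; in the quadratic one, [e <= 1] absorbs a factor
     [e] and leaves [1]. *)
  have a1 : `|X| * `|t'| <= (M * n) * (e * t) by rewrite ler_pM.
  have a2 : `|r'| * `|Y| <= (e * n) * (M * t) by rewrite ler_pM.
  have a3 : `|r'| * `|t'| <= (e * n) * (1 * t).
    by rewrite ler_pM// (le_trans ht)// ler_wpM2r.
  by rewrite (le_trans (lerD (lerD a1 a2) a3))//; lra.
have := half Aj Bj Ak Bk rj tk hAj hBj hAk hBk hrj htk.
have := half Ak Bk Aj Bj rk tj hAk hBk hAj hBj hrk htj.
set U := _ * (T1 * Aj + T2 * Bj + tj); set V := _ * (T1 * Ak + T2 * Bk + tk).
move=> h1 h2.
rewrite [X in `|X|](_ : _ = (V - (N1 * Aj + N2 * Bj) * (T1 * Ak + T2 * Bk)) -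
   (U - (N1 * Ak + N2 * Bk) * (T1 * Aj + T2 * Bj))); last by ring.
by rewrite (le_trans (ler_normB _ _))// (le_trans (lerD h2 h1))//; lra.
Qed.

Section local.
Variables (n : nat) (s : R * R -> 'rV[R]_n).

(** In the constant, [n * n] bounds the number of coordinates of the wedge product,
    [2 * (2 * M + 1) * e] is the perturbation of one coordinate, and [mirror_cross] bounds the
    product of lengths by four times the determinant. *)
Lemma mirror_term_estimate a b c d M e : tri_det a b c != 0 ->
  0 <= e -> e <= 1 ->
  (forall u, ball b d u -> forall i j, derivable (Defs.comp s j) u (ebasis R i)) ->
  (forall u, ball b d u -> forall i j,
     `|pd i (Defs.comp s j) u - pd i (Defs.comp s j) b| <= e) ->
  (forall i j, `|pd i (Defs.comp s j) b| <= M) ->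
  dist2 a b < d -> dist2 b c < d ->
  `|4^-1 * wedge_norm (s (mirror a b c) - s a) (s c - s b) -
    wedge_norm (pds ix1 s b) (pds ix2 s b) * (`|tri_det a b c| / 2)| <=
  (n * n)%:R * (4 * (2 * M + 1)) * e * (`|tri_det a b c| / 2).
Proof.
move=> D0 e0 e1 hd hpd hM dab dbc.
have Bb : ball b d b by apply: ballxx; apply: le_lt_trans dab; exact: sqrtr_ge0.
have Ba : ball b d a by apply: dist2_ball; rewrite dist2C.
have Bc : ball b d c by apply: dist2_ball.
have Bm : ball b d (mirror a b c) by apply: dist2_ball; rewrite dist2C dist2_mirror.
have [cr1 cr2] := mirror_cross _ _ _ D0.
move: cr1 cr2 => /=; set N1 := (mirror _ _ _).1 - _; set N2 := (mirror _ _ _).2 - _.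
set T1 := c.1 - b.1; set T2 := c.2 - b.2; set D := tri_det _ _ _ => cr1 cr2.
set A := pds ix1 s b; set B := pds ix2 s b.
(* The cross product of the diagonals is [2 * D], so this is the term with the remainders dropped,
   and the two wedge products can be compared coordinate by coordinate. *)
have -> : wedge_norm A B * (`|D| / 2) = 4^-1 * wedge_norm ((2 * D) *: A) B.
  by rewrite wedge_normZ normrM ger0_norm//; field.
rewrite -mulrBr normrM ger0_norm ?invr_ge0//.
rewrite [leRHS](_ : _ = 4^-1 * ((n * n)%:R * (2 * (2 * M + 1) * e * (4 * `|D|))));
  last by field.
rewrite ler_wpM2l// ?invr_ge0//.
apply: (le_trans (wedge_norm_dist _ _ _ _ _ _)).
pose X := 2 * (2 * M + 1) * e * (4 * `|D|).
(* Nonnegativity of [M] is drawn from a coordinate index, because for [n = 0] nothing constrains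
   [M]. *)
have M0 (i : 'I_n) : 0 <= M by apply: le_trans (hM ix1 i).
apply: (@le_trans _ _ (\sum_(p : 'I_n * 'I_n) X)); last first.
  by rewrite sumr_const card_prod card_ord -/X mulr_natl.
rewrite big_mkcond; apply: ler_sum => p _.
have X0 : 0 <= X by rewrite !mulr_ge0// addr_ge0// mulr_ge0// (M0 p.1).
case: ifP => // _.
have inc j y z := @increment_bound R (Defs.comp s j) b y z d e
  (fun u hu i => hd u hu i j) (fun u hu i => hpd u hu i j).
pose r j := Defs.comp s j (mirror a b c) - Defs.comp s j a -
  (N1 * A ord0 j + N2 * B ord0 j).
pose t j := Defs.comp s j c - Defs.comp s j b - (T1 * A ord0 j + T2 * B ord0 j).
have hr j : `|r j| <= e * (`|N1| + `|N2|).
  by have := inc j _ _ Bm Ba; rewrite /r /A /B !mxE.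
have ht j : `|t j| <= e * (`|T1| + `|T2|).
  by have := inc j _ _ Bc Bb; rewrite /t /A /B !mxE.
have hA j : `|A ord0 j| <= M by rewrite mxE.
have hB j : `|B ord0 j| <= M by rewrite mxE.
have sr j : (s (mirror a b c) - s a) ord0 j = N1 * A ord0 j + N2 * B ord0 j + r j.
  by rewrite 2!mxE /r subrKC.
have st j : (s c - s b) ord0 j = T1 * A ord0 j + T2 * B ord0 j + t j.
  by rewrite 2!mxE /t subrKC.
have P := @cross_perturbation N1 N2 T1 T2 _ _ _ _ _ _ _ _ M e e0 e1
  (hA p.1) (hA p.2) (hB p.1) (hB p.2)
  (hr p.1) (hr p.2) (ht p.1) (ht p.2).
apply: (@le_trans _ _
  (2 * (2 * M + 1) * e * ((`|N1| + `|N2|) * (`|T1| + `|T2|)))); last first.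
  by rewrite ler_wpM2l// !mulr_ge0// addr_ge0// mulr_ge0// (M0 p.1).
apply: le_trans P.
have S j : (2 * D *: A) ord0 j = 2 * D * A ord0 j by rewrite mxE.
rewrite /wedge_coord !sr !st !S cr1.
clearbody r t A B D.
by rewrite [2 * D * _ * _ - _](_ : _ =
  2 * D * (A ord0 p.1 * B ord0 p.2 - A ord0 p.2 * B ord0 p.1)); last by ring.
Qed.

End local.

End mirror_estimate.

(** * Convexity of balls and summation over the partition *)

Lemma triangle_ball (R : realType) (a b c z : R * R) (d : R) :
  ball b d a -> ball b d c -> triangle a b c z -> ball b d z.
Proof.
move=> [a1 a2] [c1 c2] [l1 [l2 [l3 [h1 h2 h3 h4 ->]]]].
have H (x y w : R) : `|x - y| < d -> `|x - w| < d ->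
    `|x - (l1 * y + l2 * x + l3 * w)| < d.
  move=> hy hw.
  have -> : x - (l1 * y + l2 * x + l3 * w) = l1 * (x - y) + l3 * (x - w).
    by rewrite (_ : l2 = 1 - l1 - l3); [ring|lra].
  pose m := Num.max `|x - y| `|x - w|.
  have md : m < d by rewrite /m gt_max hy hw.
  apply: le_lt_trans md; rewrite (le_trans (ler_normD _ _))//.
  rewrite !normrM (ger0_norm h1) (ger0_norm h3).
  have m1 : l1 * `|x - y| <= l1 * m by rewrite ler_wpM2l// le_max lexx.
  have m2 : l3 * `|x - w| <= l3 * m by rewrite ler_wpM2l// le_max lexx orbT.
  have m3 : (l1 + l3) * m <= 1 * m.
    by rewrite ler_wpM2r ?le_max ?normr_ge0//; lra.
  lra.
by split; exact: H.
Qed.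

Theorem theorem3 (R : realType) (n : nat) (Omega P : set (R * R))
    (s : R * R -> 'rV[R]_n) :
  open Omega -> compact_polygon P -> P `<=` Omega ->
  smooth_surface Omega s ->
  forall eps : R, 0 < eps ->
  exists2 delta : R, 0 < delta &
    forall Pi : seq ((R * R) * (R * R) * (R * R)),
      admissible_partition Omega P Pi -> mesh Pi < delta ->
      (`| (\int[@leb2 R]_(x in P)
              (wedge_norm (pds ix1 s x) (pds ix2 s x))%:E)
          - (mirror_sum s Pi)%:E | < eps%:E)%E.
Proof.
move=> oO polP PO ss eps eps0.
have [cptP mP fP] := polygon_compact_finite R P polP.
pose W x := wedge_norm (pds ix1 s x) (pds ix2 s x).
have cpd i j x : Omega x -> {for x, continuous (pd i (Defs.comp s j))}.
  by move=> Ox; have [+ _] := ss j; move=> /(_ _ Ox)[_ _ + _ _]; apply.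
have dpd i j x : Omega x -> derivable (Defs.comp s j) x (ebasis R i).
  by move=> Ox; have [+ _] := ss j; move=> /(_ _ Ox)[_ + _ _ _]; apply.
have cW x : Omega x -> {for x, continuous W}.
  have pdsE i j : (fun y => pds i s y ord0 j) = pd i (Defs.comp s j).
    by apply/funext => y; rewrite mxE.
  by move=> Ox; apply: wedge_norm_continuous => j; rewrite pdsE; exact: cpd.
have W0 x : 0 <= W x by exact: sqrtr_ge0.
have [M [M0 HM]] : exists M, 0 <= M /\
    forall i j x, P x -> `|pd i (Defs.comp s j) x| <= M.
  (* Each partial derivative is bounded by every large [M]; intersecting over the finitely many [i]
     and [j] yields a common bound. *)
  have : \forall M \near +oo, 0 <= M /\
      forall i j x, P x -> `|pd i (Defs.comp s j) x| <= M.
    have bd i j := compact_norm_bound _ _ _ _ cptP PO (cpd i j).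
    apply: filterI; first exact: nbhs_pinfty_ge.
    exact: (filter_forall _ (fun i => filter_forall _ (bd i))).
  exact: filter_ex.
pose V := fine (plane_measure R P).
have VE : plane_measure R P = V%:E by rewrite fineK// ge0_fin_numE.
have V0 : 0 <= V by apply: fine_ge0; exact: measure_ge0.
pose K : R := (n * n)%:R * (4 * (2 * M + 1)).
have K0 : 0 <= K by rewrite !mulr_ge0// addr_ge0// mulr_ge0.
have KV0 : 0 < (K + 1) * (V + 1) by rewrite mulr_gt0//; lra.
(* In [K + 1], the [K] pays for the mirror term and the [1] for the oscillation of [W] on a
   triangle. Using [V + 1] keeps the denominator positive and makes the bound [eV] strict. *)
pose e : R := Num.min 1 (eps / ((K + 1) * (V + 1))).
have e0 : 0 < e by rewrite lt_min ltr01 divr_gt0.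
have e1 : e <= 1 by rewrite ge_min lexx.
have eV : (K + 1) * e * V < eps.
  have : e * ((K + 1) * (V + 1)) <= eps by rewrite -ler_pdivlMr// ge_min lexx orbT.
  have : 0 < (K + 1) * e by rewrite mulr_gt0//; lra.
  lra.
(* One radius serves [W] and all partial derivatives; it is the required [delta]. *)
have [d [d0 [HdW Hd]]] : exists d, 0 < d /\
    ((forall x y, P x -> ball x d y -> Omega y /\ `|W y - W x| < e) /\
    forall i j x y, P x -> ball x d y -> Omega y /\
      `|pd i (Defs.comp s j) y - pd i (Defs.comp s j) x| < e).
  have : \forall d \near 0^'+, 0 < d /\
    ((forall x y, P x -> ball x d y -> Omega y /\ `|W y - W x| < e) /\
    forall i j x y, P x -> ball x d y -> Omega y /\
      `|pd i (Defs.comp s j) y - pd i (Defs.comp s j) x| < e).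
    have bd i j := near_compact_ball _ _ _ _ _ cptP oO PO e0 (cpd i j).
    apply: filterI; first exact: nbhs_right_gt.
    apply: filterI; first exact: near_compact_ball.
    exact: (filter_forall _ (fun i => filter_forall _ (bd i))).
  exact: filter_ex.
exists d => // Pi [ndg _ dis PE] meshd.
pose G := g_sigma_algebraType R.-ocitv.-measurable.
have mW : @measurable_fun _ _ (G * G)%type _ P (EFin \o W).
  apply/measurable_EFinP.
  apply: (@measurable_funS _ _ _ _ Omega) => //; first exact: open_measurable_prod.
  exact: continuous_on_open_measurable.
pose m (t : (R * R) * (R * R) * (R * R)) := `|tri_det t.1.1 t.1.2 t.2| / 2.
pose r t := fine (\int[plane_measure R]_(z in interior (tri_of t)) (W z)%:E)%E.
have VS : V = \sum_(t <- Pi) m t.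
  by apply: EFin_inj; rewrite -VE; exact: measure_partition.
pose w t := wedge_norm (s (mirror t.1.1 t.1.2 t.2) - s t.1.1) (s t.2 - s t.1.2).
(* The integral over a triangle and its mirror term are both compared with [W b * m t], the
   integrand at the vertex [b] times the area. *)
have main t : t \in Pi ->
    (\int[plane_measure R]_(z in interior (tri_of t)) (W z)%:E)%E = (r t)%:E /\
    `|r t - 4^-1 * w t| <= (K + 1) * e * m t.
  case: t => [[a b] c] tPi.
  have D0 : tri_det a b c != 0 by exact: (ndg _ tPi).
  have td : tri_diam (a, b, c) < d.
    by apply: le_lt_trans meshd; exact: (@le_bigmax_seq _ _ _ Pi 0 (a, b, c) xpredT).
  move: td; rewrite /tri_diam /= !gt_max => /and3P[dab dbc _].
  have TP : triangle a b c `<=` P by move=> z Tz; rewrite PE; exists (a, b, c).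
  have Pb : P b.
    apply: TP; exists 0, 1, 0; split => //; first by ring.
    by rewrite [LHS]surjective_pairing; congr pair; ring.
  have Ba : ball b d a by apply: dist2_ball; rewrite dist2C.
  have Bc : ball b d c by apply: dist2_ball.
  have est := @mirror_term_estimate R n s a b c d M e D0 (ltW e0) e1.
  have {}est : `|4^-1 * w (a, b, c) - W b * m (a, b, c)| <= K * e * m (a, b, c).
    apply: est => //.
    - by move=> u ub i j; apply: dpd; have [] := HdW b u Pb ub.
    - by move=> u ub i j; have [_ /ltW] := Hd i j b u Pb ub.
    - by move=> i j; exact: HM.
  have mI := open_interior_measurable R (triangle a b c).
  have [||||||r' rE rB] := @integral_near_const R _ _ (plane_measure R)
    (interior (triangle a b c)) W (m (a, b, c)) (W b) e mI.
  - apply/measurable_EFinP; apply: measurable_funS mW => //.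
    by apply: subset_trans TP; exact: interior_subset.
  - exact: measure_interior_triangle.
  - by move=> z _; exact: W0.
  - exact: W0.
  - exact: ltW.
  - move=> z /interior_subset /(triangle_ball _ _ _ _ _ _ Ba Bc) bz.
    by have [_ /ltW] := HdW b z Pb bz.
  have rr : r (a, b, c) = r' by rewrite /r /tri_of /= rE.
  rewrite rr; split => //.
  rewrite (_ : r' - _ = (r' - W b * m (a, b, c)) -
    (4^-1 * w (a, b, c) - W b * m (a, b, c))); last by ring.
  by rewrite (le_trans (ler_normB _ _))// (le_trans (lerD rB est))//; lra.
(* The integral over [P] is thus a real number, and the claim becomes an inequality between finite
   real sums. *)
have IE : (\int[@leb2 R]_(x in P) (W x)%:E)%E = (\sum_(t <- Pi) r t)%:E.
  apply: (etrans (integral_partition _ Pi P (EFin \o W) ndg dis PE mP mW _)).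
    by move=> z _; rewrite lee_fin.
  by rewrite -sumEFin !big_seq; apply: eq_bigr => t /main[].
rewrite [X in (X - _)%E]IE -EFinB /= lte_fin.
apply: le_lt_trans eV; rewrite /mirror_sum -/w mulr_sumr -sumrB VS mulr_sumr.
rewrite (le_trans (ler_norm_sum _ _ _))// big_seq [leRHS]big_seq.
by apply: ler_sum => t /main[].
Qed.
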